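(* Let $m\ge1$ and let $\mathcal F_m$ be the family of stationary binary processes generated by full-support binary context machines of order $m$ with pairwise distinct parameters. If $P\in\mathcal F_m$ is generated by the machine with parameters $(p_u)_{u\in\{0,1\}^m}$, then $$p_u=\frac{P_{m+1}(u1)}{P_m(u)}\qquad\text{for every }u\in\{0,1\}^m,$$ so that within $\mathcal F_m$ the block law of length $m+1$ determines all the parameters. The horizon $m+1$ is sharp: there are $P,Q\in\mathcal F_m$ with $P_m=Q_m$ whose generating machines are not isomorphic.
   Context: The full-support binary context machine of order $m\ge1$ with parameters $p_u\in(0,1)$, $u\in\{0,1\}^m$, has state set $\{0,1\}^m$, update $\delta(u,x)=u_2\cdots u_mx$ for $u=u_1\cdots u_m$, $x\in\{0,1\}$ (equal to $x$ when $m=1$), and emission probabilities $e_u(1)=p_u$, $e_u(0)=1-p_u$. Its dynamics are $P(X_{t+1}=x,S_{t+1}=\delta(u,x)\mid S_t=u)=e_u(x)$; $\pi$ denotes the unique stationary distribution of the resulting state chain, and the process generated by the machine is the observable process $(X_t)_{t\in\mathbb Z}$ of the stationary joint law with $S_0\sim\pi$. The parameters are pairwise distinct if the $2^m$ numbers $p_u$ are pairwise distinct. Block laws: $P_n(w)=P(X_1=w_1,\dots,X_n=w_n)$ for $w\in\{0,1\}^n$; $u1$ denotes the word $u$ followed by the symbol $1$. Two such machines $(\mathcal S,\pi,\delta,e)$ and $(\mathcal S',\pi',\delta',e')$ are isomorphic if there is a bijection $f:\mathcal S\to\mathcal S'$ with $\pi'(f(\sigma))=\pi(\sigma)$, $e'_{f(\sigma)}(x)=e_\sigma(x)$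 and $\delta'(f(\sigma),x)=f(\delta(\sigma,x))$ for all states $\sigma$ and symbols $x$. *)

(* Defs.v *)
From HB Require Import structures.
From mathcomp Require Import all_boot all_order all_algebra.
From mathcomp Require Import all_classical all_reals all_analysis.

Set Implicit Arguments.
Unset Strict Implicit.
Unset Printing Implicit Defensive.

Import Order.TTheory GRing.Theory Num.Theory.

Local Open Scope classical_set_scope.
Local Open Scope ring_scope.

(* The sequence space A^Z with the product sigma-algebra of the discrete
   sigma-algebras; A is meant to be finite. *)
Definition coordinate_events (A : Type) : set (set (int -> A)) :=
  [set E | exists (t : int) (a : A), E = [set w | w t = a]].

Definition bisequence (A : Type) := g_sigma_algebraType (@coordinate_events A).

Definition shift (A : Type) (w : int -> A) : int -> A := fun t => w (t + 1).

(* Unifilar machines over the binary alphabet; the symbols 0 and 1 are the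
   booleans false and true. *)
Record machine (R : realType) (S : Type) := Machine {
  mpi : S -> R;
  delta : S -> bool -> S;
  emit : S -> bool -> R
}.

Definition isomorphic (R : realType) (S S' : Type)
    (M : machine R S) (M' : machine R S') : Prop :=
  exists f : S -> S', bijective f /\
    forall (s : S) (x : bool),
      [/\ mpi M' (f s) = mpi M s,
          emit M' (f s) x = emit M s x
        & delta M' (f s) x = f (delta M s x)].

(* The state chain moves from s to s' with probability
   the sum of emit M s x over the symbols x with delta M s x = s'. *)
Definition transition (R : realType) (S : finType) (M : machine R S)
    (s s' : S) : R :=
  \sum_(x : bool | delta M s x == s') emit M s x.

Definition stationary_distribution (R : realType) (S : finType)
    (M : machine R S) : Prop :=
  [/\ forall s, 0 <= mpi M s,
      \sum_s mpi M s = 1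
    & forall s', mpi M s' = \sum_s mpi M s * transition M s s'].

(* Q is the law of ((X_t, S_t))_t: shift-invariant, with S_0 of law mpi M, and
     P(X_{t+1} = x, S_{t+1} = delta(u, x) | past up to t) = e_u(x)
   on {S_t = u}. The past is described by the finite histories
   (X_{t-i}, S_{t-i}) = h i, 0 <= i <= n, and the conditional probability is
   cleared of its denominator, so that null histories need no convention. *)
Definition joint_law (R : realType) (S : pointedType) (M : machine R S)
    (Q : probability (bisequence (bool * S)%type) R) : Prop :=
  [/\ forall A : set (bisequence (bool * S)%type),
        measurable A -> Q (@shift _ @^-1` A) = Q A,
      forall s : S, Q [set w | (w 0).2 = s] = (mpi M s)%:E
    & forall (t : int) (n : nat) (h : nat -> bool * S) (u : S) (x : bool),
        (h 0%N).2 = u ->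
        let past := [set w : bisequence (bool * S)%type |
                       forall i : nat, (i <= n)%N -> w (t - i%:Z) = h i] in
        Q (past `&` [set w | w (t + 1) = (x, delta M u x)])
        = ((emit M u x)%:E * Q past)%E].

(* P is the law of the observable component (X_t)_t. *)
Definition process_law (R : realType) (S : pointedType) (M : machine R S)
    (P : probability (bisequence bool) R) : Prop :=
  exists2 Q : probability (bisequence (bool * S)%type) R,
    joint_law M Q
    & forall A : set (bisequence bool), measurable A ->
        P A = Q [set w | A (fun t => (w t).1)].

(* P_n(w) = P(X_1 = w_1, ..., X_n = w_n); tuples are indexed from 0. *)
Definition block_law (R : realType) (P : probability (bisequence bool) R)
    (n : nat) (w : n.-tuple bool) : R :=
  fine (P [set x | forall i : 'I_n, x (i.+1)%:Z = tnth w i]).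

(* u_1 ... u_m, x |-> u_2 ... u_m x *)
Definition context_delta (m : nat) (u : m.-tuple bool) (x : bool) :
    m.-tuple bool :=
  [tuple of behead (rcons u x)].

Definition context_machine (R : realType) (m : nat)
    (p pi : m.-tuple bool -> R) : machine R (m.-tuple bool) :=
  Machine pi (@context_delta m) (fun u x => if x then p u else 1 - p u).

(* P is the process generated by the full-support context machine with
   parameters p and stationary distribution pi. Since every p u lies in
   ]0, 1[, the stationary distribution is unique, i.e. p determines pi. *)
Definition generated_by (R : realType) (m : nat) (p pi : m.-tuple bool -> R)
    (P : probability (bisequence bool) R) : Prop :=
  [/\ forall u, 0 < p u < 1,
      stationary_distribution (context_machine p pi)
    & process_law (context_machine p pi) P].

Definition context_family (R : realType) (m : nat)
    (P : probability (bisequence bool) R) : Prop :=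
  exists p pi : m.-tuple bool -> R, injective p /\ generated_by p pi P.

(* Main.v *)
Require Import Defs.
From HB Require Import structures.
From mathcomp Require Import all_boot all_order all_algebra.
From mathcomp Require Import all_classical all_reals all_analysis.
From mathcomp Require Import lra zify.

(* The state after m steps is the word of the last m symbols, so almost surely
   {X_1 ... X_m = u} = {S_m = u}. Hence P_m(u) = pi(u), which is positive by
   full support, and P_{m+1}(u1) = pi(u) p_u.

   For sharpness, note that the uniform law pi = 2^-m is stationary as soon as
   p_{0v} + p_{1v} = 1 for all v. The parameters 1/2 -+ eps r(v), with r a
   numbering of {0,1}^(m-1) from 1, satisfy this, are pairwise distinct, and
   for different eps they form different sets of values although P_m is uniform.

   The existence of the process is a Kolmogorov extension for binary words:
   the coordinates are read off a uniform point of [0, 1] by subdividing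
   intervals in proportion to the block probabilities, exploring the times in
   the order 0, -1, 1, -2, 2, ... *)

Set Implicit Arguments.
Unset Strict Implicit.
Unset Printing Implicit Defensive.

Import Order.TTheory GRing.Theory Num.Theory.

Local Open Scope classical_set_scope.
Local Open Scope ring_scope.

(** * Machines and their joint laws *)

Lemma measurable_coordinate (A : pointedType) (t : int) (B : set A) :
  finite_set [set: A] -> measurable [set w : bisequence A | B (w t)].
Proof.
move=> finA.
rewrite (_ : mkset _ = \bigcup_(a in B) [set w : bisequence A | w t = a]).
  apply: fin_bigcup_measurable; first exact: sub_finite_set finA.
  by move=> a _; apply: sub_sigma_algebra; exists t, a.
by apply/seteqP; split => [w Bw|w [a Ba /= ->]] //; exists (w t).
Qed.

Lemma measurable_shift (A : pointedType) :
  measurable_fun [set: bisequence A] (@Defs.shift A : bisequence A -> bisequence A).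
Proof.
apply: (@measurability _ _ (bisequence A) (bisequence A) setT
  (@Defs.shift A) (@coordinate_events A) erefl) => _ [_ [t [a ->]] <-].
by rewrite setTI; apply: sub_sigma_algebra; exists (t + 1), a.
Qed.

Lemma probability_bool_split d (T : measurableType d) (R : realType)
    (P : probability T R) (E : set T) (b : T -> bool) :
  measurable E -> (forall x, measurable [set w | b w = x]) ->
  P E = (P (E `&` [set w | b w = true]) + P (E `&` [set w | b w = false]))%E.
Proof.
move=> mE mb; rewrite -measureU; do ?exact: measurableI; last first.
  by apply/seteqP; split => // w [[_ /= ->] []].
rewrite -setIUr (_ : _ `|` _ = setT) ?setIT//.
by apply/seteqP; split => // w _ /=; case: (b w); [left|right].
Qed.

Lemma measure_eq_off_null d (T : measurableType d) (R : realType)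
    (mu : {measure set T -> \bar R}) (A B N : set T) :
  measurable A -> measurable B -> measurable N -> mu N = 0%E ->
  (forall w, ~ N w -> A w <-> B w) -> mu A = mu B.
Proof.
move=> mA mB mN N0 AB.
have le C D : measurable C -> measurable D ->
    (forall w, ~ N w -> C w -> D w) -> (mu C <= mu D)%E.
  move=> mC mD CD; apply: (@le_trans _ _ (mu (D `|` N))); last first.
    by apply: le_trans (measureU2 mu mD mN) _; rewrite [X in (_ + X)%E]N0 adde0.
  apply: le_measure; rewrite ?inE//; first exact: measurableU.
  by move=> w Cw; have [Nw|Nw] := pselect (N w); [right|left; exact: CD].
by apply/eqP; rewrite eq_le !le// => w /AB [].
Qed.

Section joint_law_theory.
Context {R : realType} {S : pointedType} (M : machine R S).
Context (Q : probability (bisequence (bool * S)%type) R).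
Hypothesis finS : finite_set [set: S].
Hypothesis emit_ge0 : forall s x, 0 <= emit M s x.
Hypothesis emit1 : forall s, emit M s true + emit M s false = 1.
Hypothesis jQ : joint_law M Q.

Lemma finite_observation : finite_set [set: bool * S].
Proof. by rewrite -setXTT; apply: finite_setX => //; exact: finite_finset. Qed.

Lemma joint_law_step (t : int) (a x : bool) (s : S) :
  Q [set w | w t = (a, s) /\ w (t + 1) = (x, delta M s x)]
  = ((emit M s x)%:E * Q [set w | w t = (a, s)])%E.
Proof.
have [_ _ /(_ t 0%N (fun=> (a, s)) s x erefl) /=] := jQ.
have -> : [set w : bisequence (bool * S)%type |
    forall i, (i <= 0)%N -> w (t - i%:Z) = (a, s)] = [set w | w t = (a, s)].
  apply/seteqP; split => w /=; first by move/(_ 0%N erefl); rewrite subr0.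
  by move=> wt i; rewrite leqn0 => /eqP->; rewrite subr0.
by move=> <-.
Qed.

Definition inconsistent (t : int) : set (bisequence (bool * S)%type) :=
  [set w | (w (t + 1)).2 <> delta M (w t).2 (w (t + 1)).1].

Lemma measurable_coordinate2 (t t' : int) (B : bool * S -> bool * S -> Prop) :
  measurable [set w : bisequence (bool * S)%type | B (w t) (w t')].
Proof.
have fin := finite_observation.
rewrite (_ : mkset _ = \bigcup_(c in [set: bool * S])
  ([set w | w t = c] `&` [set w | B c (w t')])).
  apply: fin_bigcup_measurable => // c _; apply: measurableI.
    exact: (@measurable_coordinate _ t [set c]).
  exact: (@measurable_coordinate _ t' (B c)).
by apply/seteqP; split => [w Bw|w [c _ [/= -> ]]] //; exists (w t).
Qed.

(** On each event [w t = (a, s)] the two transitions along [delta] already carry the whole mass,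
    because the emission probabilities of [s] sum to 1. Nothing is left for other successor
    states. *)
Lemma inconsistent_null (t : int) : Q (inconsistent t) = 0%E.
Proof.
have fin := finite_observation.
pose N c := inconsistent t `&` [set w | w t = c].
have mN c : measurable (N c).
  by apply: (@measurable_coordinate2 t (t + 1)
    (fun b d => d.2 <> delta M b.2 d.1 /\ b = c)).
rewrite (_ : inconsistent t = \bigcup_(c in setT) N c); last first.
  by apply/seteqP; split => [w Nw|w [c _ []]] //; exists (w t).
rewrite measure_fin_bigcup//; last by move=> c c' _ _ [w [[_ /= <-] [_ /= <-]]].
apply: fsbig1 => -[a s] _.
pose E := [set w : bisequence (bool * S)%type | w t = (a, s)].
pose F x := [set w : bisequence (bool * S)%type |
  w t = (a, s) /\ w (t + 1) = (x, delta M s x)].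
have mE : measurable E by exact: (@measurable_coordinate _ t [set (a, s)]).
have mF x : measurable (F x).
  exact: (@measurable_coordinate2 t (t + 1)
    (fun b d => b = (a, s) /\ d = (x, delta M s x))).
have EFN : E = F true `|` F false `|` N (a, s).
  apply/seteqP; split => [w Ew|w [[[]|[]]|[]]] //; have {Ew} wt : w t = (a, s) := Ew.
  have [e|ne] := pselect ((w (t + 1)).2 = delta M (w t).2 (w (t + 1)).1).
    left; have := surjective_pairing (w (t + 1)); rewrite e wt /=.
    by case: (_.1) => ws; [left|right].
  by right.
have : Q E = (Q (F true) + Q (F false) + Q (N (a, s)))%E.
  rewrite {1}EFN measureU//; [|exact: measurableU|].
    rewrite measureU//; apply/seteqP; split => // w [[_ /= ws] [_]].
    by rewrite ws.
  by apply/seteqP; split => // w [[] [/= wt ws] [+ _]];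
    rewrite /inconsistent /= wt ws.
rewrite !joint_law_step -/E -ge0_muleDl ?lee_fin// -EFinD emit1 mul1e.
rewrite -[LHS]adde0 => /esym; rewrite -/(N (a, s)).
(* Finiteness of [Q E] allows it to be cancelled, in the extended reals, from
   [Q E = Q E + Q (N (a, s))]. *)
have QE : Q E \is a fin_num by exact: fin_num_measure.
by move/(congr1 (fun z => z - Q E)%E); rewrite addeAC [in RHS]addeAC subee// !add0e.
Qed.

Lemma inconsistent_bigcup_null : Q (\bigcup_i inconsistent (Posz i)) = 0%E.
Proof.
have mN t : measurable (inconsistent t).
  exact: (@measurable_coordinate2 t (t + 1) (fun b d => d.2 <> delta M b.2 d.1)).
apply/negligibleP; first exact: bigcup_measurable.
apply: negligible_bigcup => i; apply/negligibleP => //.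
exact: inconsistent_null.
Qed.

Lemma joint_law_eq (A B : set (bisequence (bool * S)%type)) :
  measurable A -> measurable B ->
  (forall w, ~ (\bigcup_i inconsistent (Posz i)) w -> A w <-> B w) ->
  Q A = Q B.
Proof.
move=> mA mB; apply: measure_eq_off_null inconsistent_bigcup_null => //.
apply: bigcup_measurable => i _.
exact: (@measurable_coordinate2 i (i%:Z + 1) (fun b d => d.2 <> delta M b.2 d.1)).
Qed.

(** The symbol at time i + 1 is the one emitted on leaving the state of time i, hence the index
    [i.+1]: the states from time 0 to n are driven by the symbols of times 1 to n. *)
Lemma state_foldl (w : int -> bool * S) (n : nat) :
  ~ (\bigcup_i inconsistent (Posz i)) w ->
  (w n%:Z).2 = foldl (delta M) (w 0).2 [seq (w i.+1%:Z).1 | i <- iota 0 n].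
Proof.
move=> cw; elim: n => // n IH.
have e : (n.+1%:Z = n%:Z + 1) by rewrite addrC -intS.
rewrite -[in iota _ _]addn1 iotaD map_cat foldl_cat -IH add0n /=.
by apply: contrapT => ne; apply: cw; exists n => //; rewrite /inconsistent /= -e.
Qed.

Lemma state_law (n : nat) (s : S) : Q [set w | (w n%:Z).2 = s] = (Defs.mpi M s)%:E.
Proof.
have [inv init _] := jQ; elim: n => [//|n <-].
rewrite -[RHS]inv; last first.
  exact: (@measurable_coordinate _ n%:Z [set c : bool * S | c.2 = s] finite_observation).
by rewrite /preimage /Defs.shift /= addrC -intS.
Qed.

End joint_law_theory.

Lemma measurable_coordinates (A : pointedType) (I : finType) (t : I -> int)
    (B : I -> set A) : finite_set [set: A] ->
  measurable [set w : bisequence A | forall i, B i (w (t i))].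
Proof.
move=> finA.
rewrite (_ : mkset _ = \bigcap_(i in setT) [set w : bisequence A | B i (w (t i))]).
  by apply: fin_bigcap_measurable => [|i _];
    [exact: finite_finset | exact: measurable_coordinate].
by apply/seteqP; split => [w Bw i _|w Bw i]; apply: Bw.
Qed.

(** Each update appends a symbol and forgets the oldest one, so the state is a sliding window on the
    input. *)
Lemma foldl_context_delta m (u : m.-tuple bool) (l : seq bool) :
  foldl (@context_delta m) u l = drop (size l) (u ++ l) :> seq bool.
Proof.
elim: l u => [|x l IH] u; first by rewrite cats0 drop0.
rewrite /= {}IH /= -cats1; case: u => -[|a u] sz /=; last by rewrite -catA.
by rewrite drop_size.
Qed.

(** * Positivity and block laws of context machines *)

Section context_machine_theory.
Context {R : realType} {m : nat} (p pi : m.-tuple bool -> R).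
Hypothesis p01 : forall u, 0 < p u < 1.
Let M := context_machine p pi.

Lemma context_emit_gt0 u x : 0 < emit M u x.
Proof. by have /andP[? ?] := p01 u; case: x; rewrite //= subr_gt0. Qed.

(** Some state has positive mass because the masses sum to 1. Positivity passes along transitions
    because all emissions are positive, and reading the m symbols of [u] leads from any state to
    [u]. *)
Lemma stationary_context_gt0 : stationary_distribution M -> forall u, 0 < pi u.
Proof.
move=> [/= pi0 pi1 pist].
have step s x : 0 < pi s -> 0 < pi (context_delta s x).
  move=> s0; rewrite pist (bigD1 s)//=; apply: ltr_pwDl; last first.
    apply: sumr_ge0 => i _; apply: mulr_ge0 => //; apply: sumr_ge0 => y _.
    exact: ltW (context_emit_gt0 _ _).
  apply: mulr_gt0 => //; rewrite /transition (bigD1 x)//=; apply: ltr_pwDl.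
    exact: context_emit_gt0.
  by apply: sumr_ge0 => y _; exact: ltW (context_emit_gt0 _ _).
have [s s0] : exists s, 0 < pi s.
  apply/existsP; rewrite -[X in is_true X]negbK; apply/negP.
  move=> /existsPn nogt; have := @ltr01 R; rewrite -pi1 big1 ?ltxx// => s _.
  by apply/eqP; rewrite eq_le pi0 andbT leNgt nogt.
have steps l : 0 < pi (foldl (@context_delta m) s l).
  by elim/last_ind: l => // l x IH; rewrite foldl_rcons; exact: step.
move=> u; suff <- : foldl (@context_delta m) s u = u by exact: steps.
by apply: val_inj; rewrite /= foldl_context_delta drop_size_cat// !size_tuple.
Qed.

Context (P : probability (bisequence bool) R).
Context (Q : probability (bisequence (bool * m.-tuple bool)%type) R).
Hypothesis jQ : joint_law M Q.
Hypothesis PQ : forall A : set (bisequence bool), measurable A ->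
  P A = Q [set v | A (fun t => (v t).1)].

Let fin_bool : finite_set [set: bool]. Proof. exact: finite_finset. Qed.
Let fin_state : finite_set [set: m.-tuple bool]. Proof. exact: finite_finset. Qed.
Let fin_joint : finite_set [set: bool * m.-tuple bool]. Proof. exact: finite_finset. Qed.

Lemma block_law_joint n (w : n.-tuple bool) :
  block_law P w
  = fine (Q [set v | [seq (v i.+1%:Z).1 | i <- iota 0 n] = w]).
Proof.
rewrite /block_law PQ.
  congr (fine (Q _)); apply/seteqP; split => v /= vw.
    apply: (@eq_from_nth _ false) => [|i]; rewrite size_map size_iota ?size_tuple// => ni.
    by rewrite (nth_map 0%N) ?size_iota// nth_iota// (vw (Ordinal ni)) (tnth_nth false).
  move=> i; rewrite (tnth_nth false) -vw (nth_map 0%N) ?size_iota//.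
  by rewrite nth_iota.
exact: (@measurable_coordinates bool _ (fun i : 'I_n => (i.+1)%:Z)
    (fun i => [set tnth w i]) fin_bool).
Qed.

Lemma measurable_block (n : nat) (w : seq bool) :
  measurable [set v : bisequence (bool * m.-tuple bool)%type |
    [seq (v i.+1%:Z).1 | i <- iota 0 n] = w].
Proof.
have [sw|sw] := eqVneq (size w) n; last first.
  rewrite (_ : mkset _ = set0)//; apply/seteqP; split => // v /= e.
  by move: sw; rewrite -e size_map size_iota eqxx.
rewrite (_ : mkset _ = [set v | forall i : 'I_n, (v (i.+1)%:Z).1 = nth false w i]).
  apply: (@measurable_coordinates (bool * m.-tuple bool)%type _ (fun i : 'I_n => (i.+1)%:Z)
    (fun i => [set c | c.1 = nth false w i])).
  exact: finite_finset.
apply/seteqP; split => v /= vw.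
  by move=> i; rewrite -vw (nth_map 0%N) ?size_iota// nth_iota.
apply: (@eq_from_nth _ false) => [|i]; rewrite size_map size_iota ?size_tuple// => ni.
by rewrite (nth_map 0%N) ?size_iota// nth_iota// (vw (Ordinal ni)).
Qed.

Lemma context_state (w : int -> bool * m.-tuple bool) :
  ~ (\bigcup_i inconsistent M (Posz i)) w ->
  (w m%:Z).2 = [seq (w i.+1%:Z).1 | i <- iota 0 m] :> seq bool.
Proof.
move=> cw; rewrite (state_foldl _ cw) foldl_context_delta drop_size_cat//.
by rewrite size_tuple size_map size_iota.
Qed.

Lemma context_joint_eq (A B : set (bisequence (bool * m.-tuple bool)%type)) :
  measurable A -> measurable B ->
  (forall w, ~ (\bigcup_i inconsistent M (Posz i)) w -> A w <-> B w) ->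
  Q A = Q B.
Proof.
apply: (@joint_law_eq _ _ M) => //; first by move=> *; exact/ltW/context_emit_gt0.
by move=> s; rewrite /= addrC subrK.
Qed.

Lemma context_state_law (u : m.-tuple bool) :
  Q [set v | (v m%:Z).2 = u] = (pi u)%:E.
Proof. exact: (@state_law _ _ M). Qed.

Lemma block_law_context (u : m.-tuple bool) : block_law P u = pi u.
Proof.
rewrite block_law_joint.
rewrite (@context_joint_eq _ [set v | (v m%:Z).2 = u]) ?context_state_law//.
- exact: measurable_block.
- exact: (@measurable_coordinate _ m%:Z [set c : bool * m.-tuple bool | c.2 = u]).
- by move=> v /context_state /= <-; split => [/val_inj|->].
Qed.

Lemma block_law_context_rcons (u : m.-tuple bool) (x : bool) :
  block_law P [tuple of rcons u x] = emit M u x * pi u.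
Proof.
rewrite block_law_joint -[RHS]/(fine (emit M u x * pi u)%:E).
congr fine; rewrite EFinM -context_state_law.
pose B b := [set v : bisequence (bool * m.-tuple bool)%type | (v m%:Z).1 = b].
have mB b : measurable (B b).
  exact: (@measurable_coordinate _ m%:Z [set c : bool * m.-tuple bool | c.1 = b]).
(* Almost surely the block event is [F]: state [u] at time m, followed by the transition that emits
   [x]. *)
pose F := [set v : bisequence (bool * m.-tuple bool)%type |
  (v m%:Z).2 = u /\ v (m%:Z + 1) = (x, context_delta u x)].
have mF : measurable F.
  exact: (@measurable_coordinate2 _ fin_state m%:Z (m%:Z + 1)
    (fun b d => b.2 = u /\ d = (x, context_delta u x))).
rewrite (@context_joint_eq _ F) //; first last.
- move=> v cv; have e := context_state cv.
  have iotaS : iota 0 m.+1 = rcons (iota 0 m) m by rewrite -addn1 iotaD cats1.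
  rewrite /F /mkset iotaS map_rcons -e intS addrC; split.
    move=> /rcons_inj [/val_inj eu ex]; split => //.
    rewrite [LHS]surjective_pairing ex; congr pair.
    apply: contrapT => ne; apply: cv; exists m => //.
    by rewrite /inconsistent /= eu ex.
  by move=> [-> ->].
- exact: measurable_block.
rewrite (@probability_bool_split _ _ _ Q F (fun v => (v m%:Z).1))//.
rewrite [in RHS](@probability_bool_split _ _ _ Q _ (fun v => (v m%:Z).1))//; last first.
  exact: (@measurable_coordinate _ m%:Z [set c : bool * m.-tuple bool | c.2 = u]).
rewrite ge0_muleDr//.
(* A history in [joint_law] fixes the symbol as well as the state, so the transition rule applies
   only after splitting by the symbol at time m. *)
have step a : Q (F `&` B a) = ((emit M u x)%:E * Q ([set v | (v m%:Z).2 = u] `&` B a))%E.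
  rewrite (_ : F `&` B a = [set v | v m%:Z = (a, u) /\ v (m%:Z + 1) = (x, context_delta u x)]).
    rewrite (_ : _ `&` B a = [set v | v m%:Z = (a, u)]).
      exact: (joint_law_step jQ).
    apply/seteqP; split => v; last by move=> /= vm; split; rewrite /B/= vm.
    by case=> /= vu va; rewrite [LHS]surjective_pairing vu va.
  apply/seteqP; split => v; last by case=> /= vm vx; split; rewrite /F/B/= vm.
  by case=> /= -[vu vx] va; split => //; rewrite [LHS]surjective_pairing vu va.
by congr (_ + _)%E; exact: step.
Qed.

End context_machine_theory.

Lemma context_parameter (R : realType) m (P : probability (bisequence bool) R)
    (p pi : m.-tuple bool -> R) : generated_by p pi P ->
  forall u, p u = block_law P [tuple of rcons u true] / block_law P u.
Proof.
move=> [p01 st [Q jQ PQ]] u.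
rewrite (block_law_context_rcons p01 jQ PQ).
rewrite (block_law_context p01 jQ PQ) mulfK//.
by rewrite gt_eqF// (stationary_context_gt0 p01).
Qed.

(** Makes the denominator in [context_parameter] a function of the block law of length m + 1, so
    that this law alone determines the parameters. *)
Lemma block_law_marginal (R : realType) n (P : probability (bisequence bool) R)
    (w : n.-tuple bool) :
  block_law P w = block_law P [tuple of rcons w true]
                  + block_law P [tuple of rcons w false].
Proof.
have mw k (v : k.-tuple bool) :
    measurable [set x : bisequence bool | forall i : 'I_k, x (i.+1)%:Z = tnth v i].
  apply: (@measurable_coordinates bool _ (fun i : 'I_k => (i.+1)%:Z)
    (fun i => [set tnth v i])).
  exact: finite_finset.
have mb b : measurable [set x : bisequence bool | x (n.+1)%:Z = b].
  apply: (@measurable_coordinate bool (n.+1)%:Z [set b]); exact: finite_finset.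
rewrite /block_law (@probability_bool_split _ _ _ P _ (fun x => x (n.+1)%:Z))//.
rewrite fineD ?fin_num_measure//; do ?exact: measurableI.
have step b : [set x : bisequence bool | forall i : 'I_n, x (i.+1)%:Z = tnth w i]
    `&` [set x | x (n.+1)%:Z = b] =
  [set x | forall i : 'I_n.+1, x (i.+1)%:Z = tnth [tuple of rcons w b] i].
  apply/seteqP; split => x /=.
    move=> [xw xb] i; rewrite (tnth_nth false) /= nth_rcons size_tuple.
    have := ltn_ord i; rewrite ltnS leq_eqVlt => /orP[/eqP->|i_n].
      by rewrite ltnn eqxx.
    by rewrite i_n (xw (Ordinal i_n)) (tnth_nth false).
  move=> xw; split => [i|].
    have := xw (widen_ord (leqnSn n) i).
    by rewrite !(tnth_nth false) /= nth_rcons size_tuple ltn_ord.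
  have := xw ord_max.
  by rewrite (tnth_nth false) /= nth_rcons size_tuple ltnn eqxx.
by rewrite !step.
Qed.

(** * Stationary extension of consistent block laws *)

Section nested_intervals.
Context {R : realType} (nu : seq bool -> R).
Hypothesis nu_ge0 : forall c, 0 <= nu c.
Hypothesis nu_nil : nu [::] = 1.
Hypothesis nu_cons : forall c, nu (true :: c) + nu (false :: c) = nu c.

(** The interval of [c] starts here and has length [nu c]; it is cut into that of [false :: c] on
    the left and that of [true :: c] on the right. *)
Fixpoint left_end (c : seq bool) : R :=
  if c is b :: c' then left_end c' + (if b then nu (false :: c') else 0) else 0.

(* The list of the first [n] symbols read off [x], last one first. *)
Fixpoint code (n : nat) (x : R) : seq bool :=
  if n is n'.+1 then
    let c := code n' x in (left_end (true :: c) <= x) :: c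
  else [::].

Lemma size_code n x : size (code n x) = n.
Proof. by elim: n => //= n ->. Qed.

Lemma left_end_ge0 c : 0 <= left_end c.
Proof. by elim: c => //= -[] c IH; rewrite ?addr0 // addr_ge0. Qed.

Lemma right_end_le1 c : left_end c + nu c <= 1.
Proof.
elim: c => [|[] c IH] /=; first by rewrite add0r nu_nil.
  by apply: le_trans IH; rewrite -(nu_cons c); lra.
by apply: le_trans IH; rewrite -(nu_cons c); have := nu_ge0 (true :: c); lra.
Qed.

(** The next symbol records on which side of the cut of the interval of [c] the point lies, the cut
    being the left end of the [true] child. The bounds on [x] serve the empty word, whose interval
    is [0, 1). *)
Lemma code_eq c (x : R) : 0 <= x < 1 ->
  code (size c) x = c <-> left_end c <= x < left_end c + nu c.
Proof.
move=> x01; elim: c => [|b c IH] /=; first by rewrite nu_nil add0r x01.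
have c1 := nu_ge0 (true :: c); have c0 := nu_ge0 (false :: c).
have cc := nu_cons c.
split.
  move=> [xb cx]; move: (cx); rewrite IH; move: xb; rewrite cx.
  by case: b => /=; case: (lerP (left_end c + nu (false :: c)) x) => // ? _
    /andP[? ?]; apply/andP; split; lra.
move=> /andP[l r]; have cx : code (size c) x = c.
  by apply/IH/andP; split; move: l r; case: b => /=; lra.
rewrite cx; congr cons.
by move: l r; case: b => /= l r; [apply/idP|apply/negbTE; rewrite -ltNge]; lra.
Qed.

Lemma measurable_code n c :
  measurable [set x : measurableTypeR R | code n x = c].
Proof.
elim: n c => [|n IH] [|b c] /=.
- by rewrite (_ : mkset _ = setT)//; apply/seteqP; split.
- by rewrite (_ : mkset _ = set0)//; apply/seteqP; split.
- by rewrite (_ : mkset _ = set0)//; apply/seteqP; split.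
rewrite (_ : mkset _ = [set x | code n x = c]
    `&` (if b then `[left_end (true :: c), +oo[%classic
         else `]-oo, left_end (true :: c)[%classic)).
  by apply: measurableI => //; case: b; exact: measurable_itv.
apply/seteqP; split => x /=.
  by move=> [xb cx]; rewrite cx in xb; rewrite -xb; split=> //;
    case: lerP => /=; rewrite in_itv/= ?andbT.
move=> [cx]; rewrite cx => xb; congr cons.
by case: b xb => /=; rewrite in_itv/= ?andbT// => /lt_geF.
Qed.

Let U : probability (measurableTypeR R) R := uniform_prob (@ltr01 R).

Lemma uniform_prob_itvco (a b : R) : 0 <= a -> a <= b -> b <= 1 ->
  U `[a, b[%classic = (b - a)%:E.
Proof.
move=> a0 ab b1.
rewrite /U /= /uniform_prob integral_uniform_pdf setIidl; last first.
  by move=> x /=; rewrite !in_itv/= => /andP[? ?]; apply/andP; split; lra.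
rewrite (eq_integral (fun=> 1%:E)); last first.
  move=> x; rewrite inE/= in_itv/= => /andP[? ?]; rewrite /uniform_pdf.
  by rewrite ifT ?subr0 ?invr1//; apply/andP; split; lra.
rewrite integral_cst//= mul1e lebesgue_measure_itv/= lte_fin.
case: ltP => // ba; rewrite (_ : b - a = 0)//; lra.
Qed.

(** Up to the null complement of [0, 1), the event is an interval of length [nu c]. *)
Lemma uniform_code c : U [set x | code (size c) x = c] = (nu c)%:E.
Proof.
have -> : nu c = (left_end c + nu c) - left_end c by rewrite addrAC subrr add0r.
rewrite -uniform_prob_itvco ?left_end_ge0 ?right_end_le1 ?lerDl//.
apply: (@measure_eq_off_null _ _ _ U _ _ (~` `[0, 1[%classic)).
- exact: measurable_code.
- exact: measurable_itv.
- by apply: measurableC; exact: measurable_itv.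
- have := probability_setC U (measurable_itv `[0, 1[).
  by rewrite uniform_prob_itvco// subr0 subee.
move=> x /contrapT /=; rewrite !in_itv/= => x01; exact: code_eq.
Qed.

Definition bit (n : nat) (x : R) : bool := head false (code n.+1 x).

Lemma code_bit n x : code n x = rev (mkseq (bit^~ x) n).
Proof.
by elim: n => // n IH; rewrite mkseqS rev_rcons -IH.
Qed.

Lemma measurable_bit n b : measurable [set x : measurableTypeR R | bit n x = b].
Proof.
rewrite (_ : mkset _ =
  \bigcup_(c in [set: n.+1.-tuple bool])
    (if head false c == b then [set x | code n.+1 x = c] else set0)).
  apply: fin_bigcup_measurable => [|c _]; first exact: finite_finset.
  by case: ifP => // _; exact: measurable_code.
apply/seteqP; split => x /=.
  move=> xb; have sz : size (code n.+1 x) == n.+1 by rewrite size_code.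
  by exists (Tuple sz) => //=; rewrite -xb ifT//; exact/eqP.
by move=> [c _]; case: eqP => // <- /= <-.
Qed.

End nested_intervals.

(** * Windows of a two-sided sequence and the order of exploration *)

Definition window (A : Type) (y : int -> A) (t : int) (n : nat) : seq A :=
  [seq y (t - i%:Z) | i <- iota 0 n].

Lemma size_window (A : Type) (y : int -> A) t n : size (window y t n) = n.
Proof. by rewrite size_map size_iota. Qed.

Lemma nth_window (A : Type) a0 (y : int -> A) t n i : (i < n)%N ->
  nth a0 (window y t n) i = y (t - i%:Z).
Proof. by move=> ni; rewrite (nth_map 0%N) ?size_iota// nth_iota. Qed.

Lemma windowS (A : Type) (y : int -> A) t n :
  window y t n.+1 = y t :: window y (t - 1) n.
Proof.
rewrite /window /= subr0 -[1%N]/(1 + 0)%N iotaDl -map_comp; congr cons.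
by apply: eq_map => i /=; rewrite PoszD opprD addrA.
Qed.

Lemma window_rcons (A : Type) (y : int -> A) t n :
  window y t n.+1 = rcons (window y t n) (y (t - n%:Z)).
Proof. by rewrite /window -addn1 iotaD map_cat cats1 add0n. Qed.

Lemma take_window (A : Type) (y : int -> A) t n k : (k <= n)%N ->
  take k (window y t n) = window y t k.
Proof. by move=> kn; rewrite /window -map_take take_iota (minn_idPl kn). Qed.

Lemma drop_window (A : Type) (y : int -> A) t n k :
  drop k (window y t (k + n)) = window y (t - k%:Z) n.
Proof.
elim: k t => [|k IH] t; first by rewrite drop0 subr0.
by rewrite addSn windowS /= IH intS opprD addrA.
Qed.

Lemma window_shift (A : Type) (y : int -> A) t n :
  window (Defs.shift y) t n = window y (t + 1) n.
Proof. by apply: eq_map => i; rewrite /Defs.shift addrAC. Qed.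

Lemma eq_window (A : Type) (y y' : int -> A) t n :
  window y t n = window y' t n <->
  forall i, (i < n)%N -> y (t - i%:Z) = y' (t - i%:Z).
Proof.
split=> [e i ni|e]; first by have := nth_window (y 0) y t ni; rewrite e nth_window.
by apply/eq_in_map => i; rewrite mem_iota add0n => /andP[_]; exact: e.
Qed.

Lemma measurable_window (t : int) (n : nat) (w : seq bool) :
  measurable [set y : bisequence bool | window y t n = w].
Proof.
have [sw|sw] := eqVneq (size w) n; last first.
  rewrite (_ : mkset _ = set0)//; apply/seteqP; split => // y /= e.
  by move: sw; rewrite -e size_window eqxx.
rewrite (_ : mkset _ = [set y | forall i : 'I_n, y (t - (i : nat)%:Z) = nth false w i]).
  apply: (@measurable_coordinates bool _ (fun i : 'I_n => t - (i : nat)%:Z)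
    (fun i => [set nth false w i])).
  exact: finite_finset.
apply/seteqP; split => y /= yw.
  by move=> i; rewrite -yw nth_window.
apply: (@eq_from_nth _ false) => [|i]; rewrite size_window ?sw// => ni.
by rewrite nth_window// (yw (Ordinal ni)).
Qed.

(* [c] lists the symbols in the order of exploration, last one first; the
   result, like [window], is in chronological order, most recent symbol first. *)
Fixpoint interleave (c : seq bool) : seq bool :=
  if c is b :: c' then
    if odd (size c') then rcons (interleave c') b else b :: interleave c'
  else [::].

Lemma size_interleave c : size (interleave c) = size c.
Proof. by elim: c => //= b c IH; case: ifP; rewrite ?size_rcons /= IH. Qed.

Lemma interleave_inj c c' : size c = size c' -> interleave c = interleave c' -> c = c'.
Proof.
elim: c c' => [|b c IH] [|b' c'] //= [sc]; rewrite -sc.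
by case: ifP => _; [move=> /rcons_inj []|case] => [/(IH _ sc) -> ->|-> /(IH _ sc) ->].
Qed.

(** The parity of the length tells at which end the last explored symbol sits, so it can be stripped
    off. *)
Lemma interleave_surj w : exists c, interleave c = w.
Proof.
elim: {w}(size w) {-2}w (leqnn (size w)) => [|n IH] w.
  by case: w => // _; exists [::].
case: (boolP (odd (size w))) => ow sw.
  case: w ow sw => // b w /= ow sw; have [c cw] := IH w sw; exists (b :: c).
  by rewrite /= -(size_interleave c) cw (negbTE ow).
case/lastP: w ow sw => [|w b]; first by exists [::].
rewrite size_rcons /= negbK => ow sw; have [c cw] := IH w sw; exists (b :: c).
by rewrite /= -(size_interleave c) cw ow.
Qed.

(** The rank of [t], counted from 0, in the order 0, -1, 1, -2, 2, ... *)
Definition time_code (t : int) : nat :=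
  match t with Posz j => j.*2 | Negz j => j.*2.+1 end.

(** The times of rank below k are consecutive and end at [uphalf k - 1]. For odd k the next time
    explored precedes them all, for even k it follows them all. *)
Lemma interleave_window (beta : nat -> bool) k :
  interleave (rev (mkseq beta k))
  = window (fun t => beta (time_code t)) ((uphalf k)%:Z - 1) k.
Proof.
elim: k => // k IH; rewrite mkseqS rev_rcons /= size_rev size_mkseq {}IH.
case: (boolP (odd k)) => ok.
  rewrite uphalf_half ok add1n window_rcons.
  have -> : (k./2.+1%:Z - 1 - k%:Z) = Negz k./2 by lia.
  have kE : (k./2).*2.+1 = k by lia.
  rewrite /= kE; congr (rcons (window _ _ _) _); lia.
rewrite windowS uphalf_half (negbTE ok) add0n.
have -> : (k./2.+1%:Z - 1) = Posz k./2 by lia.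
have kE : (k./2).*2 = k by lia.
by rewrite /= kE.
Qed.

HB.instance Definition _ (A : pointedType) :=
  isMeasurableFun.Build _ _ (bisequence A) (bisequence A)
    (@Defs.shift A : bisequence A -> bisequence A) (@measurable_shift A).

(** * The shift-invariant law with given window probabilities *)

Section stationary_extension.
Context {R : realType} (mu : seq bool -> R).
Hypothesis mu_ge0 : forall w, 0 <= mu w.
Hypothesis mu_nil : mu [::] = 1.
Hypothesis mu_cons : forall w, mu (true :: w) + mu (false :: w) = mu w.
Hypothesis mu_rcons : forall w, mu (rcons w true) + mu (rcons w false) = mu w.

Let nu c := mu (interleave c).

(** Exploration extends a window at its newest or its oldest end according to parity; [mu_cons]
    settles the one case and [mu_rcons] the other. *)
Let nu_cons c : nu (true :: c) + nu (false :: c) = nu c.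
Proof. by rewrite /nu /=; case: ifP. Qed.

Let nu_ge0 c : 0 <= nu c. Proof. exact: mu_ge0. Qed.

Let sample_path (x : measurableTypeR R) : bisequence bool :=
  fun t => bit nu (time_code t) x.

Let measurable_sample_path : measurable_fun setT sample_path.
Proof.
apply: (@measurability _ _ _ (bisequence bool) setT sample_path
  (@coordinate_events bool) erefl) => _ [_ [t [a ->]] <-].
by rewrite setTI; exact: measurable_bit.
Qed.

HB.instance Definition _ := isMeasurableFun.Build _ _ _ _ sample_path measurable_sample_path.

Definition stationary_extension : probability (bisequence bool) R :=
  distribution (uniform_prob (@ltr01 R)) sample_path.

Local Notation P := stationary_extension.

Let window_law t n := forall w, size w = n ->
  P [set y | window y t n = w] = (mu w)%:E.

(** The explored windows correspond bijectively to codes, whose probabilities are given by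
    [uniform_code]. *)
Let window_law_centered k : window_law ((uphalf k)%:Z - 1) k.
Proof.
move=> w sw; have [c cw] := interleave_surj w.
rewrite -cw -/(nu c) -(@uniform_code _ nu)//.
rewrite /P /= /distribution /pushforward /preimage /=; congr (_ _).
have sc : size c = k by rewrite -sw -cw size_interleave.
rewrite sc; apply/seteqP; split => x /=; rewrite code_bit => e.
  by apply: interleave_inj; rewrite ?size_rev ?size_mkseq// interleave_window.
by rewrite -e interleave_window.
Qed.

Let window_law_newest t n : window_law (t + 1) n.+1 -> window_law t n.
Proof.
move=> law w sw.
rewrite (@probability_bool_split _ _ _ P _ (fun y => y (t + 1))); last 2 first.
- exact: measurable_window.
- move=> b; apply: (@measurable_coordinate bool (t + 1) [set b]).
  exact: finite_finset.
rewrite -mu_cons EFinD -!law /= ?sw//.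
by congr (P _ + P _)%E; apply/seteqP; split => y /=; rewrite windowS addrK;
  [move=> [-> ->]|case=> -> ->|move=> [-> ->]|case=> -> ->].
Qed.

Let window_law_oldest t n : window_law t n.+1 -> window_law t n.
Proof.
move=> law w sw.
rewrite (@probability_bool_split _ _ _ P _ (fun y => y (t - n%:Z))); last 2 first.
- exact: measurable_window.
- move=> b; apply: (@measurable_coordinate bool (t - n%:Z) [set b]).
  exact: finite_finset.
rewrite -mu_rcons EFinD -!law /= ?size_rcons ?sw//.
by congr (P _ + P _)%E; apply/seteqP; split => y /=; rewrite window_rcons;
  [move=> [-> ->]|move/rcons_inj => [-> ->]|move=> [-> ->]|move/rcons_inj => [-> ->]].
Qed.

Theorem stationary_extension_window t w :
  P [set y | window y t (size w) = w] = (mu w)%:E.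
Proof.
suff : window_law t (size w) by exact.
have newest a s n : window_law (s + a%:Z) (n + a) -> window_law s n.
  elim: a s n => [|a IH] s n; first by rewrite addr0 addn0.
  rewrite intS addrA -addSnnS => /IH; exact: window_law_newest.
have oldest a s n : window_law s (n + a) -> window_law s n.
  by elim: a s n => [|a IH] s n; rewrite ?addn0// -addSnnS => /IH; exact: window_law_oldest.
(* With j = |t| + n, this window covers the times from -j to j, among them the n times ending at
   [t]. Summing out its [b] newest and [a] oldest times leaves the required window. *)
have := @window_law_centered (`|t|%N + size w).*2.+1.
move: (size w) => n.
set j := (`|t|%N + n)%N => law.
pose a := absz (j%:Z + t + 1 - n%:Z)%R; pose b := absz (j%:Z - t)%R.
apply: (oldest a); apply: (newest b).
have -> : t + b%:Z = (uphalf j.*2.+1)%:Z - 1 by rewrite /b /j; lia.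
suff -> : (n + a + b = j.*2.+1)%N by [].
by rewrite /a /b /j; lia.
Qed.

(** The law and its image under the shift agree on cylinders over centred windows, since the
    probability of a window does not depend on its position. These cylinders, with the empty set,
    form a generating pi-system. *)
Theorem stationary_extension_shift (A : set (bisequence bool)) :
  measurable A -> P (@Defs.shift _ @^-1` A) = P A.
Proof.
pose cyl j w := [set y : bisequence bool | window y (j%:Z - 1) j.*2 = w].
pose G := [set A | A = set0 \/ exists j w, A = cyl j w].
have mcyl j w : measurable (cyl j w) by exact: measurable_window.
have cylI j w j' w' : (j <= j')%N -> cyl j w `&` cyl j' w' = set0 \/
    cyl j w `&` cyl j' w' = cyl j' w'.
  move=> jj'.
  (* The window of [j] sits inside that of [j']: j' - j times are dropped at each end. Hence the
     finer cylinder is either contained in the coarser one or disjoint from it. *)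
  have sub y : window y (j%:Z - 1) j.*2
      = take j.*2 (drop (j' - j) (window y (j'%:Z - 1) j'.*2)).
    have -> : (j'.*2 = (j' - j) + (j' + j))%N by lia.
    rewrite drop_window take_window; last by lia.
    by congr window; lia.
  have [e|ne] := eqVneq (take j.*2 (drop (j' - j) w')) w; [right|left].
    apply/seteqP; split => y; first by case.
    by move=> yw; split => //; rewrite /cyl /= sub yw.
  apply/seteqP; split => // y [+ yw]; rewrite /cyl /= sub yw => e.
  by rewrite e eqxx in ne.
have cyl0 : cyl 0%N [::] = setT by apply/seteqP; split.
have G_gen : @measurable _ (bisequence bool) = <<s G >>.
  apply/seteqP; split.
    apply: smallest_sub; first exact: smallest_sigma_algebra.
    move=> _ [t [a ->]].
    (* The window from -j to j - 1 contains [t] when j = |t| + 1; [i] is the position of [t] in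
       it. *)
    pose j := (absz t).+1; pose i := absz (j%:Z - 1 - t)%R.
    rewrite (_ : mkset _ = \bigcup_(w in [set w : j.*2.-tuple bool | nth false w i = a])
        cyl j w); last first.
      have ij : (i < j.*2)%N by rewrite /i /j; lia.
      have it : j%:Z - 1 - i%:Z = t by rewrite /i /j; lia.
      apply/seteqP; split => y /=.
        move=> ya; have sz : size (window y (j%:Z - 1) j.*2) == j.*2.
          by rewrite size_window.
        by exists (Tuple sz) => //=; rewrite nth_window// it.
      by move=> [w /= wa yw]; rewrite -it -(nth_window false _ _ ij) yw.
    apply: (@fin_bigcup_measurable _ (g_sigma_algebraType G)).
      exact: finite_finset.
    by move=> w _; apply: sub_sigma_algebra; right; exists j, w.
  apply: smallest_sub; first exact: sigma_algebra_measurable.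
  by move=> _ [->|[j [w ->]]].
have GI : setI_closed G.
  move=> A1 A2 [->|[j [w ->]]]; first by left; rewrite set0I.
  move=> [->|[j' [w' ->]]]; first by left; rewrite setI0.
  have [jj'|/ltnW j'j] := leqP j j'.
    by have [->|->] := cylI j w j' w' jj'; [left|right; exists j', w'].
  by rewrite setIC; have [->|->] := cylI j' w' j w j'j; [left|right; exists j, w].
apply: (@measure_unique _ _ _ G (fun=> setT) G_gen GI _ _
  (distribution P (@Defs.shift bool : bisequence bool -> bisequence bool)) P).
- by move=> _; right; exists 0%N, [::].
- by rewrite bigcup_const.
- move=> _ [->|[j [w ->]]]; first by rewrite !measure0.
  have [sw|sw] := eqVneq (size w) j.*2; last first.
    have -> : cyl j w = set0.
      by apply/seteqP; split => // y yw; move: sw; rewrite -yw size_window eqxx.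
    by rewrite !measure0.
  rewrite /distribution /pushforward /cyl -sw [RHS]stationary_extension_window.
  rewrite -(stationary_extension_window (j%:Z - 1 + 1)); congr (P _).
  by apply/seteqP; split => y /=; rewrite window_shift.
- by move=> _; apply: (le_lt_trans (probability_le1 _ measurableT)); rewrite ltry.
Qed.

End stationary_extension.

(** * Machines with uniform stationary distribution *)

(* Words list the most recent symbol first, contexts list it last. The default
   value of [insubd] is reached only when [size w < m]. *)
Definition context m (w : seq bool) : m.-tuple bool :=
  insubd (nseq_tuple m false) (rev (take m w)).

Lemma val_context m w : (m <= size w)%N -> context m w = rev (take m w) :> seq bool.
Proof. by move=> mw; rewrite [LHS]val_insubd size_rev size_takel// eqxx. Qed.

Lemma context_take m w k : (m <= k)%N -> context m (take k w) = context m w.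
Proof. by move=> mk; rewrite /context take_takel. Qed.

Lemma context_inj m w w' : size w = m -> size w' = m ->
  context m w = context m w' -> w = w'.
Proof.
move=> sw sw' /(congr1 (@tval _ _)); rewrite !val_context ?sw ?sw'//.
by rewrite -{1}sw -{1}sw' !take_size => /(can_inj revK).
Qed.

Lemma context_rev m (u : m.-tuple bool) : context m (rev u) = u.
Proof.
apply: val_inj; rewrite /= val_context ?size_rev ?size_tuple//.
by rewrite take_oversize ?size_rev ?size_tuple// revK.
Qed.

Lemma context_cons m w x : (m <= size w)%N ->
  context m (x :: w) = context_delta (context m w) x.
Proof.
move=> mw; apply: val_inj; rewrite /= !val_context//; last exact: leqW.
case: m mw => [|m] mw /=; first by rewrite take0.
by rewrite (take_nth false)// rev_rcons rev_cons /=.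
Qed.

Section balanced_context.
Context {R : realType} {k : nat} (p : k.+1.-tuple bool -> R).
Hypothesis p01 : forall u, 0 < p u < 1.
Hypothesis balanced : forall v : k.-tuple bool,
  p [tuple of true :: v] + p [tuple of false :: v] = 1.

Local Notation m := k.+1.
Let pi (u : m.-tuple bool) : R := 2^-1 ^+ m.
Let M := context_machine p pi.

(** The intended probability of a window, most recent symbol first. Starting with m fair bits means
    starting the machine from the uniform law [pi] on contexts. *)
Fixpoint balanced_block (w : seq bool) : R :=
  if w is x :: w' then
    balanced_block w' * (if (size w' < m)%N then 2^-1 else emit M (context m w') x)
  else 1.

Local Notation mu := balanced_block.

Let emit_sum u : emit M u true + emit M u false = 1.
Proof. by rewrite /= addrC subrK. Qed.

Lemma balanced_block_ge0 w : 0 <= mu w.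
Proof.
elim: w => //= x w IH; apply: mulr_ge0 => //; case: ifP => _; first by rewrite invr_ge0.
exact: ltW (context_emit_gt0 pi p01 _ x).
Qed.

Lemma balanced_block_short w : (size w <= m)%N -> mu w = 2^-1 ^+ size w.
Proof. by elim: w => //= x w IH sw; rewrite sw IH ?exprSr// ltnW. Qed.

Lemma balanced_block_cons w : mu (true :: w) + mu (false :: w) = mu w.
Proof.
rewrite /= -mulrDr; case: ifP => _; last by rewrite -[X in _ * X]/(_ + _) emit_sum mulr1.
by rewrite -[2^-1]mul1r -splitr mulr1.
Qed.

(** The varying symbol is the oldest one, hence the first letter of the context: this is [balanced]
    for [true], and its complement for [false]. *)
Lemma balanced_emit (v : seq bool) x : size v = k ->
  emit M (context m (rcons v true)) x + emit M (context m (rcons v false)) x = 1.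
Proof.
move=> sv; have ctx b : context m (rcons v b) = [tuple of b :: rev_tuple (Tuple (introT eqP sv))].
  apply: val_inj; rewrite /= val_context ?size_rcons ?sv//.
  by rewrite take_oversize ?size_rcons ?sv// rev_rcons.
rewrite !ctx /=; case: x; first by rewrite balanced.
by have := balanced (rev_tuple (Tuple (introT eqP sv))); lra.
Qed.

Lemma balanced_block_rcons w : mu (rcons w true) + mu (rcons w false) = mu w.
Proof.
elim: w => [|x w IH]; first by rewrite /= !mul1r -[2^-1]mul1r -splitr.
rewrite /= !size_rcons -[in RHS]IH; have [sw|sw] := ltnP (size w).+1 m.
  by rewrite (ltn_trans _ sw)// mulrDl.
(* At this length the symbol summed out is the oldest letter of the context of [x]: here balance is
   needed. *)
have [e|ne] := eqVneq (size w) k.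
  rewrite !balanced_block_short ?size_rcons ?e// ltnSn -mulrDr.
  rewrite [X in _ * X]balanced_emit// mulr1.
  lra.
(* Now [w] contains the whole context of [x], which therefore ignores the symbol summed out. *)
have mw : (m <= size w)%N by lia.
rewrite ltnNge mw /= mulrDl.
have ctx b : context m (rcons w b) = context m w.
  by rewrite /context -cats1 takel_cat.
by rewrite !ctx.
Qed.

Let P := stationary_extension mu.
Let P_window := stationary_extension_window balanced_block_ge0 erefl
  balanced_block_cons balanced_block_rcons.
Let P_shift := stationary_extension_shift balanced_block_ge0 erefl
  balanced_block_cons balanced_block_rcons.

(** Since states are functions of the last m symbols, the joint law can be taken as the image of the
    observable law. *)
Definition observe (y : bisequence bool) : bisequence (bool * m.-tuple bool)%type :=
  fun t => (y t, context m (window y t m)).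

Lemma measurable_observe : measurable_fun setT observe.
Proof.
apply: (@measurability _ _ _ (bisequence (bool * m.-tuple bool)%type) setT observe
  (@coordinate_events _) erefl) => _ [_ [t [[x u] ->]] <-].
rewrite setTI (_ : _ @^-1` _ = [set y | window y t m = rev u] `&`
   [set y : bisequence bool | y t = x]).
  apply: measurableI; first exact: measurable_window.
  by apply: (@measurable_coordinate bool t [set x]); exact: finite_finset.
apply/seteqP; split => y /=; rewrite /observe; last by case=> -> ->; rewrite context_rev.
move=> [-> yu]; split => //; apply: (@context_inj m).
- exact: size_window.
- by rewrite size_rev size_tuple.
- by rewrite yu context_rev.
Qed.

HB.instance Definition _ := isMeasurableFun.Build _ _ _ _ observe measurable_observe.

Lemma observe_shift y : observe (Defs.shift y) = Defs.shift (observe y).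
Proof. by apply/funext => t; rewrite /observe window_shift. Qed.

Lemma balanced_joint_law : joint_law M (distribution P observe).
Proof.
split.
- move=> A mA; rewrite /distribution /pushforward.
  rewrite -[RHS]P_shift; last by rewrite -[X in measurable X]setTI; exact: measurable_observe.
  by congr (P _); apply/seteqP; split => y /=; rewrite observe_shift.
- move=> s; rewrite /distribution /pushforward.
  have -> : Defs.mpi M s = mu (rev s) by rewrite balanced_block_short size_rev size_tuple.
  rewrite -(P_window 0); congr (P _); rewrite size_rev size_tuple.
  apply/seteqP; split => y /= ys; last by rewrite ys context_rev.
  apply: (@context_inj m); rewrite ?size_window ?size_rev ?size_tuple//.
  by rewrite ys context_rev.
move=> t n h u x hu past; rewrite /distribution /pushforward.
pose past' := observe @^-1` past.
(* A realizable history of n + 1 states amounts to a fixed window of n + m symbols. *)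
have pastE y : past' y -> past' = [set z | window z t (n + m) = window y t (n + m)].
  move=> py; apply/seteqP; split => z /=.
    move=> pz; apply/eq_window => l ln.
    (* The symbol of time t - l is read in the state of time t - i, at depth j < m. *)
    pose i := minn l n; pose j := (l - i)%N.
    have -> : t - l%:Z = t - i%:Z - j%:Z by rewrite /j /i; lia.
    have jm : (j < m)%N by rewrite /j /i; lia.
    suff /eq_window/(_ j jm) : window z (t - i%:Z) m = window y (t - i%:Z) m by [].
    apply: (@context_inj m); rewrite ?size_window//.
    have iN : (i <= n)%N by rewrite /i; lia.
    by have := pz i iN; rewrite -(py i iN) => -[].
  move=> /eq_window yz i iN; rewrite -(py i iN) /observe; congr (_, context _ _).
    by apply: yz; lia.
  apply/eq_window => j jm.
  have -> : t - i%:Z - j%:Z = t - (i + j)%N%:Z by lia.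
  by apply: yz; lia.
rewrite -[LHS]/(P (past' `&` (observe @^-1` [set v | v (t + 1) = (x, delta M u x)]))).
rewrite -[X in (_ * X)%E]/(P past').
(* An unrealizable history is an empty event, for which both sides vanish. *)
have [[y py]|np] := pselect (exists y, past' y); last first.
  have -> : past' = set0 by apply/seteqP; split => // y py; apply: np; exists y.
  by rewrite set0I !measure0 mule0.
have := pastE y py; set w := window y t (n + m) => pw.
have sw : size w = (n + m)%N by rewrite size_window.
have cw z : window z t (n + m) = w -> context m (window z t m) = u.
  move=> zw; rewrite -(@take_window _ z t (n + m)%N) ?leq_addl// zw take_window ?leq_addl//.
  by have := py 0%N (leq0n n); rewrite subr0 -hu => <-.
(* The new state is forced by the window, so only the symbol [x] is added; as size w >= m, the
   recursion of [balanced_block] then yields the emission factor. *)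
have -> : past' `&` (observe @^-1` [set v | v (t + 1) = (x, delta M u x)])
    = [set z | window z (t + 1) (size (x :: w)) = x :: w].
  rewrite pw /= sw; apply/seteqP; split => z /=; rewrite windowS addrK.
    by case=> -> [->].
  case=> zx zw; split => //; rewrite /observe zx; congr pair.
  rewrite -(@take_window _ z (t + 1) (n + m).+1); last by lia.
  rewrite context_take// windowS addrK zx zw context_cons ?sw ?leq_addl//.
  by rewrite -(cw y erefl) -/w -(@take_window _ y t (n + m)%N) ?leq_addl// context_take.
rewrite P_window pw -sw P_window -EFinM /= sw ltnNge leq_addl /= mulrC.
by rewrite -(cw y erefl) -(@take_window _ y t (n + m)%N) ?leq_addl// context_take.
Qed.

(** A state vx has the two predecessors 1v and 0v, whose probabilities of emitting x sum to 1 by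
    balance, so the uniform law is preserved. *)
Lemma balanced_stationary : stationary_distribution M.
Proof.
have pi0 (u : m.-tuple bool) : 0 <= pi u by rewrite exprn_ge0// invr_ge0.
split => // [|s'].
  by rewrite sumr_const card_tuple card_bool -[LHS]mulr_natr natrX -exprMn mulVf ?expr1n//.
rewrite -mulr_sumr.
have [v [x s'E]] : exists (v : k.-tuple bool) x, s' = rcons v x :> seq bool.
  exists (rev_tuple [tuple of behead (rev s')]), (last false s').
  rewrite /=; case/lastP: (tval s') (size_tuple s') => // w a _.
  by rewrite last_rcons rev_rcons /= revK.
pose u b : m.-tuple bool := [tuple of b :: v].
have tr s : transition M s s' = if behead s == v then emit M s x else 0.
  rewrite /transition big_mkcond big_bool; case: (tupleP s) => b w.
  rewrite -!val_eqE /= s'E !eqseq_rcons.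
  by case: (tval w == v) => //=; case: (x); rewrite ?addr0 ?add0r.
rewrite (eq_bigr _ (fun s _ => tr s)) (bigD1 (u true))//= eqxx.
rewrite (bigD1 (u false))//= eqxx big1 ?addr0; last first.
  move=> s; case: (tupleP s) => b w; rewrite -!val_eqE /= !eqseq_cons.
  by case: (tval w =P v) => [e|//]; case: (b); rewrite ?andbF /= ?e ?eqxx.
have -> : (if x then p (u true) else 1 - p (u true)) +
    (if x then p (u false) else 1 - p (u false)) = 1.
  by have := balanced v; rewrite -/(u true) -/(u false); case: (x) => ?; lra.
by rewrite mulr1.
Qed.

Lemma balanced_generated : exists P, generated_by p pi P.
Proof.
exists P; split => //; first exact: balanced_stationary.
by exists (distribution P observe); [exact: balanced_joint_law|].
Qed.

End balanced_context.

(** * A family of balanced, pairwise distinct parameters *)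

Section twisted_parameter.
Context {R : realType} {k : nat}.

Definition twisted_parameter (eps : R) (u : k.+1.-tuple bool) : R :=
  2^-1 + (if thead u then eps else - eps) * (enum_rank (behead_tuple u)).+1%:R.

Lemma twisted_parameter01 eps u : 0 < eps -> eps * (2 ^ k)%:R < 2^-1 ->
  0 < twisted_parameter eps u < 1.
Proof.
move=> eps0 small; rewrite /twisted_parameter.
set r := enum_rank _; have rk : (r.+1 <= 2 ^ k)%N.
  by rewrite -[X in (X ^ _)%N]card_bool -card_tuple ltn_ord.
have r0 : 0 < eps * r.+1%:R by rewrite mulr_gt0// ltr0n.
have r1 : eps * r.+1%:R < 2^-1.
  by apply: le_lt_trans small; rewrite ler_pM2l// ler_nat.
by case: ifP => _; rewrite ?mulNr; apply/andP; split; lra.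
Qed.

Lemma twisted_parameter_balanced eps (v : k.-tuple bool) :
  twisted_parameter eps [tuple of true :: v]
  + twisted_parameter eps [tuple of false :: v] = 1.
Proof.
rewrite /twisted_parameter.
have -> : behead_tuple [tuple of true :: v] = behead_tuple [tuple of false :: v].
  exact: val_inj.
by rewrite /thead !(tnth_nth false) /=; lra.
Qed.

(** The side of 1/2 on which the parameter lies gives the first letter and its distance to 1/2 gives
    the rest; ranks counted from 1 keep that distance nonzero. *)
Lemma twisted_parameter_inj eps : 0 < eps -> injective (twisted_parameter eps).
Proof.
move=> eps0 u u' /addrI e.
have hb : thead u = thead u' /\ behead_tuple u = behead_tuple u'.
  move: e; set r := enum_rank _; set r' := enum_rank _.
  have r0 : 0 < eps * r.+1%:R by rewrite mulr_gt0// ltr0n.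
  have r0' : 0 < eps * r'.+1%:R by rewrite mulr_gt0// ltr0n.
  have rr' : eps * r.+1%:R = eps * r'.+1%:R -> behead_tuple u = behead_tuple u'.
    move/(mulfI (lt0r_neq0 eps0)) => /eqP; rewrite eqr_nat eqSS => /eqP/val_inj.
    exact: enum_rank_inj.
  by case: (thead u); case: (thead u'); rewrite ?mulNr => e; split => //;
    try (apply: rr'; lra); exfalso; lra.
case: hb; case: (tupleP u) => b w; case: (tupleP u') => b' w'.
rewrite /thead !(tnth_nth false) /= => -> /(congr1 val) /= ww'.
by apply: val_inj; rewrite /= ww'.
Qed.

(** With [twisted_parameter_attained], this recovers [eps] from the set of parameters as their least
    distance to 1/2. *)
Lemma twisted_parameter_dist eps u : 0 < eps -> eps <= `|twisted_parameter eps u - 2^-1|.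
Proof.
move=> eps0; rewrite /twisted_parameter addrAC subrr add0r normrM normr_nat.
rewrite (_ : `|if _ then _ else _| = eps); last by case: ifP; rewrite ?normrN gtr0_norm.
by rewrite -[leLHS]mulr1 ler_pM2l// ler1n.
Qed.

Lemma twisted_parameter_attained eps : exists u : k.+1.-tuple bool,
  twisted_parameter eps u = 2^-1 + eps.
Proof.
have N0 : (0 < #|{: k.-tuple bool}|)%N by rewrite card_tuple card_bool expn_gt0.
pose v : k.-tuple bool := enum_val (Ordinal N0).
exists (cons_tuple true v).
rewrite /twisted_parameter /thead (tnth_nth false) /=.
have -> : behead_tuple (cons_tuple true v) = v by exact: val_inj.
by rewrite enum_valK mulr1.
Qed.

End twisted_parameter.

Theorem mainTheorem9 (R : realType) (m : nat) (hm : (1 <= m)%N) :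
  [/\ forall (P : probability (bisequence bool) R)
        (p pi : m.-tuple bool -> R),
        context_family m P -> generated_by p pi P ->
        forall u : m.-tuple bool,
          p u = block_law P [tuple of rcons u true] / block_law P u,
      forall (P P' : probability (bisequence bool) R)
        (p pi p' pi' : m.-tuple bool -> R),
        context_family m P -> generated_by p pi P ->
        context_family m P' -> generated_by p' pi' P' ->
        (forall w : m.+1.-tuple bool, block_law P w = block_law P' w) ->
        forall u : m.-tuple bool, p u = p' u
    & exists P Q : probability (bisequence bool) R,
        [/\ context_family m P,
            context_family m Q,
            forall w : m.-tuple bool, block_law P w = block_law Q w
          & forall p pi q qi : m.-tuple bool -> R,
              generated_by p pi P -> generated_by q qi Q ->
              ~ isomorphic (context_machine p pi) (context_machine q qi)]].
Proof.
split.
- by move=> P p pi _ gP u; exact: (context_parameter gP u).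
- move=> P P' p pi p' pi' _ gP _ gP' PP' u.
  by rewrite (context_parameter gP) (context_parameter gP') (block_law_marginal P u)
    (block_law_marginal P' u) !PP'.
case: m hm => // k _.
(* Chosen so that e * 2^k = 1/4, below the bound 1/2 of [twisted_parameter01]; halving gives a
   second admissible value. *)
pose e : R := (2 ^ k * 4)%:R^-1; pose e' := e / 2.
have e0 : 0 < e by rewrite invr_gt0 ltr0n muln_gt0 expn_gt0.
have e0' : 0 < e' by rewrite divr_gt0.
have ek : e * (2 ^ k)%:R = 4^-1.
  by rewrite /e natrM invfM mulrAC mulVf ?mul1r// pnatr_eq0 expn_eq0.
have small : e * (2 ^ k)%:R < 2^-1 by rewrite ek; lra.
have small' : e' * (2 ^ k)%:R < 2^-1 by rewrite /e' mulrAC ek; lra.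
have p01 u := twisted_parameter01 u e0 small.
have q01 u := twisted_parameter01 u e0' small'.
have [P gP] := balanced_generated p01 (twisted_parameter_balanced e).
have [Q gQ] := balanced_generated q01 (twisted_parameter_balanced e').
exists P, Q; split.
- by eexists _, _; split; [exact: (twisted_parameter_inj e0) | exact: gP].
- by eexists _, _; split; [exact: (twisted_parameter_inj e0') | exact: gQ].
- move=> w; have [_ _ [QP jQP PQ]] := gP; have [_ _ [QQ jQQ QQE]] := gQ.
  by rewrite (block_law_context p01 jQP PQ) (block_law_context q01 jQQ QQE).
move=> p pi q qi gp gq [f [[g fg gf] iso]].
(* By [context_parameter], any parameters generating P or Q are the twisted ones. An isomorphism
   would turn 1/2 + e' into a parameter of P, all of which are at distance at least e = 2e' from
   1/2. *)
have [u uE] := @twisted_parameter_attained R k e'.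
have [_ qp _] := iso (g u) true; move: qp; rewrite /= gf.
rewrite (context_parameter gq) -(context_parameter gQ) uE.
rewrite (context_parameter gp) -(context_parameter gP) => pE.
have := twisted_parameter_dist (g u) e0.
by rewrite -pE addrAC subrr add0r gtr0_norm// /e'; lra.
Qed.
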